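(* Let $k$ be an algebraically closed field of characteristic $p\ge 0$ and let $R=k[X_0,X_1,X_2]$ be the standard graded polynomial ring. Let $I$ be a homogeneous ideal of $R$ generated by a minimal generating set of homogeneous polynomials $\mathbf f:=f_0,f_1,f_2,f_3$ of the same degree $d$. Suppose that $I$ has codimension $2$, that the rational map $\phi=(f_0:f_1:f_2:f_3):\mathbb P^2_k\dashrightarrow\mathbb P^3_k$ is generically finite onto its image, and that $I_3(J(\mathbf f))\neq 0$, where $I_3(J(\mathbf f))$ is the ideal generated by the $3\times 3$ minors of the Jacobian matrix $J(\mathbf f)$. Assume further that $p$ does not divide $d$. For each $y\in\mathcal Y_1$ let $h_y\in R$ be a homogeneous polynomial defining the unmixed one-dimensional part of the fiber $\pi^{-1}(y)\subset\mathbb P^2_k$. Then $$\sum_{y\in \mathcal Y_1}\deg(h_y)\leq 3(d-1)-\mathrm{indeg}(\mathrm{Syz}(I))< 3(d-1).$$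
   Context: The Jacobian matrix of $\mathbf f$ is the $4\times 3$ matrix $J(\mathbf f)=(\partial f_i/\partial X_j)_{0\le i\le 3,\,0\le j\le 2}$. ''$\phi$ is generically finite onto its image'' means that the closed image of $\phi$ has dimension $2$. $\mathrm{Syz}(I)\subseteq R^4$ is the graded module of syzygies of $f_0,\ldots,f_3$: $(a_0,\ldots,a_3)\in R^4$ with $a_0f_0+\cdots+a_3f_3=0$, graded so that a syzygy whose entries $a_i$ are homogeneous of degree $\nu$ has degree $\nu$. For a finitely generated graded $R$-module $M$, $\mathrm{indeg}(M)=\inf\{\nu\mid M_\nu\ne 0\}$ (with $\mathrm{indeg}(0)=+\infty$). Let $B=k[T_0,\ldots,T_3]$ be the homogeneous coordinate ring of $\mathbb P^3_k$ and $\mathcal R_I=\bigoplus_{s\ge 0}I^s(sd)$ the Rees algebra of $I$, a bigraded quotient of $R[T_0,\ldots,T_3]$ via $T_i\mapsto f_i$. Let $\Gamma\subset\mathbb P^2_k\times\mathbb P^3_k$ be the subscheme defined by $\mathcal R_I$ (the Zariski closure of the graph of $\phi$), and $\pi:\Gamma\to\mathbb P^3_k$ the restriction of the second projection. For a closed point $y\in\mathbb P^3_k$ with residue field $k(y)\simeq k$, $\pi^{-1}(y)=\mathrm{Proj}(\mathcal R_I\otimes_B k(y))\subset\mathbb P^2_{k(y)}\simeq\mathbb P^2_k$ is the scheme-theoretic fiber. Set $\mathcal Y_1=\{y\in\mathbb P^3_k\text{ closed point}\mid \dim\pi^{-1}(y)=1\}$, which is a finite set under these hypotheses. For $y\in\mathcal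 Y_1$, the unmixed part of $\pi^{-1}(y)$ of dimension $1$ (defined by the intersection of the one-dimensional primary components of the homogeneous ideal of $\pi^{-1}(y)$) is a plane curve; $h_y\in R$ is its defining homogeneous polynomial (unique up to a nonzero scalar). *)

(* Defs.v *)
From HB Require Import structures.
From mathcomp Require Export all_boot all_order all_algebra.
From mathcomp Require Export finmap boolp mpoly.

Set Implicit Arguments.
Unset Strict Implicit.
Unset Printing Implicit Defensive.

Import Order.TTheory GRing.Theory Num.Theory.

Local Open Scope ring_scope.

(* Ideals are predicates [{pred R}]; as in [ring_quotient], [idealr_closed]
   includes properness.  Numerical invariants that may be infinite
   (height, dimension) are stated as relations "the invariant equals n". *)

Section CommutativeAlgebra.
Variable R : comNzRingType.

Definition gen_ideal (T : finType) (D : pred T) (F : T -> R) : {pred R} :=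
  [pred u | `[< exists a : T -> R, u = \sum_(i | D i) a i * F i >]].

Definition minimal_generators (T : finType) (F : T -> R) : Prop :=
  forall i, F i \notin gen_ideal (predC1 i) F.

(* Non-injective row or column selections contribute zero determinants. *)
Definition minors_ideal (r m n : nat) (A : 'M[R]_(m, n)) : {pred R} :=
  gen_ideal xpredT
    (fun s : {ffun 'I_r -> 'I_m} * {ffun 'I_r -> 'I_n} => \det (mxsub s.1 s.2 A)).

Definition prime_ideal (P : {pred R}) : Prop :=
  idealr_closed P /\ prime_idealr_closed P.

Definition primary_ideal (Q : {pred R}) : Prop :=
  idealr_closed Q /\
  (forall u v, u * v \in Q -> u \in Q \/ exists n : nat, v ^+ n \in Q).

Definition radical (Q : {pred R}) : {pred R} :=
  [pred u | `[< exists n : nat, u ^+ n \in Q >]].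

(* C 0 < C 1 < ... < C n *)
Definition prime_chain (n : nat) (C : nat -> {pred R}) : Prop :=
  (forall i, (i <= n)%N -> prime_ideal (C i)) /\
  (forall i, (i < n)%N -> {subset C i <= C i.+1} /\ ~ {subset C i.+1 <= C i}).

Definition height_ge (P : {pred R}) (n : nat) : Prop :=
  exists2 C, prime_chain n C & C n =i P.

Definition has_height (P : {pred R}) (n : nat) : Prop :=
  height_ge P n /\ ~ height_ge P n.+1.

(* The infimum of the heights of the primes containing I equals n. *)
Definition has_codim (I : {pred R}) (n : nat) : Prop :=
  (exists P, [/\ prime_ideal P, {subset I <= P} & has_height P n]) /\
  (forall P, prime_ideal P -> {subset I <= P} -> height_ge P n).

Definition has_characteristic (p : nat) : Prop :=
  if p == 0%N then [pchar R] =i pred0 else p \in [pchar R].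

End CommutativeAlgebra.

Section ProjectiveGeometry.
Variables (k : fieldType) (n : nat).
Local Notation S := {mpoly k[n]}.

Definition homogeneous_ideal (a : {pred S}) : Prop :=
  forall u, u \in a -> forall e, pihomog [measure of mdeg] e u \in a.

(* The points of Proj(S/a) are the homogeneous primes of S that contain a and
   do not contain the irrelevant ideal; chains of such primes correspond to
   chains of irreducible closed subsets. *)
Definition Proj_chain (a : {pred S}) (m : nat) : Prop :=
  exists C : nat -> {pred S},
    [/\ prime_chain m C,
        forall i, (i <= m)%N -> homogeneous_ideal (C i),
        {subset a <= C 0%N}
      & exists i : 'I_n, 'X_i \notin C m].

Definition Proj_dim (a : {pred S}) (m : nat) : Prop :=
  Proj_chain a m /\ ~ Proj_chain a m.+1.

Definition minimal_primary_decomposition (a : {pred S}) (s : nat)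
    (Q : 'I_s -> {pred S}) : Prop :=
  [/\ forall i, primary_ideal (Q i) /\ homogeneous_ideal (Q i),
      forall u, (u \in a) = [forall i, u \in Q i],
      forall i, ~ {subset [pred u | [forall (j | j != i), u \in Q j]] <= Q i}
    & forall i j, radical (Q i) =i radical (Q j) -> i = j].

(* h is homogeneous and generates the intersection of those primary components
   of a whose zero scheme has dimension m. *)
Definition defines_unmixed_part (a : {pred S}) (m : nat) (h : S) : Prop :=
  h \is homog [measure of mdeg] /\
  exists (s : nat) (Q : 'I_s -> {pred S}),
    minimal_primary_decomposition a Q /\
    (forall u, (exists c, u = c * h) <->
               (forall i, Proj_dim (Q i) m -> u \in Q i)).

(* Closed points of P^(n-1) over an algebraically closed k are the lines
   through the origin of k^n. *)
Definition proj_point : Type := {L : {vspace 'rV[k]_n} | \dim L == 1%N}.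
HB.instance Definition _ := Choice.on proj_point.

Definition hcoord (y : proj_point) : 'I_n -> k := vpick (val y) 0.

End ProjectiveGeometry.

Section GradedSubmodules.
Variables (k : fieldType) (n m : nat).
Local Notation S := {mpoly k[n]}.

Definition nonzero_in_degree (M : ('I_m -> S) -> Prop) (e : nat) : Prop :=
  exists a : 'I_m -> S,
    [/\ M a, forall i, a i \is e.-homog & exists i, a i != 0].

(* [None] stands for +oo. *)
Definition indeg (M : ('I_m -> S) -> Prop) : option nat :=
  match pselect (exists e, `[< nonzero_in_degree M e >]) with
  | left ex => Some (ex_minn ex)
  | right _ => None
  end.

Definition Syz (f : 'I_m -> S) : ('I_m -> S) -> Prop :=
  fun a => \sum_i a i * f i = 0.

End GradedSubmodules.

Section RationalMap.
Variable k : fieldType.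
Local Notation R := {mpoly k[3]}.
Local Notation B := {mpoly k[4]}.
Variable f : 'I_4 -> R.

Definition Jacobian : 'M[R]_(4, 3) := \matrix_(i, j) (f i)^`M(j).

(* y = (f_0(x) : ... : f_3(x)) for some x outside the base locus. *)
Definition in_image (y : proj_point k 4) : Prop :=
  exists x : 'I_3 -> k,
    let v : 'rV[k]_4 := \row_i (f i).@[x] in v != 0 /\ v \in val y.

Definition closed_image_ideal : {pred B} :=
  [pred G | `[< forall y, in_image y ->
                forall v, v \in val y -> G.@[fun i => v 0 i] = 0 >]].

Definition generically_finite : Prop := Proj_dim closed_image_ideal 2.

(* The Rees algebra is the image R[It] of R[T_0,..,T_3] -> R[t], T_i |-> f_i t;
   this is the kernel of that map. *)
Definition rees_ideal : {pred {mpoly R[4]}} :=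
  [pred F | mmap polyC (fun i => (f i)%:P * 'X) F == 0].

(* The Rees ideal is T-homogeneous, so the fiber over y is Proj of R modulo the
   ideal obtained by substituting homogeneous coordinates of y for T; the
   choice of coordinates is immaterial. *)
Definition fiber_ideal (y : proj_point k 4) : {pred R} :=
  [pred u | `[< exists2 F, F \in rees_ideal &
                u = F.@[fun i => (hcoord y i)%:MP] >]].

Definition one_dim_fiber (y : proj_point k 4) : Prop :=
  Proj_dim (fiber_ideal y) 1.

End RationalMap.

(* Main.v *)
Require Import Defs.
From mathcomp Require Import perm ring zify.

Set Implicit Arguments.
Unset Strict Implicit.
Unset Printing Implicit Defensive.

Import Order.TTheory GRing.Theory Num.Theory.
Local Open Scope ring_scope.

(* The signed maximal minors of the Jacobian matrix form a nonzero vector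
   orthogonal to its columns, hence, by Euler's formula and since p does not
   divide d, a syzygy of f of degree 3(d-1).  The fiber over y contains all
   y_i f_j - y_j f_i, so h_y divides them, the Jacobian matrix has rank at most
   2 modulo h_y, and h_y divides the syzygy.  A common prime factor of h_y and
   h_y' with y <> y' would divide all the f_i, contradicting codimension 2.
   As k[X_0, X_1, X_2] is factorial, the product of the h_y divides the syzygy
   and the quotient is a syzygy of degree 3(d-1) - sum of the deg h_y.  No
   syzygy has degree 0 because the f_i are minimal generators.  The h_y being
   nonconstant, the same degree bound makes the set of the y finite. *)

(** * Unique factorization *)

Section Divides.
Variable A : comNzRingType.
Implicit Types a b q u : A.

Definition divides q u : Prop := exists c, u = c * q.

Lemma divides0 q : divides q 0.
Proof. by exists 0; rewrite mul0r. Qed.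

Lemma dividesMl q a u : divides q u -> divides q (a * u).
Proof. by case=> c ->; exists (a * c); rewrite mulrA. Qed.

Lemma dividesMr q a u : divides q u -> divides q (u * a).
Proof. by rewrite mulrC; apply: dividesMl. Qed.

Lemma dividesD q a b : divides q a -> divides q b -> divides q (a + b).
Proof. by move=> [c ->] [c' ->]; exists (c + c'); rewrite mulrDl. Qed.

Lemma dividesB q a b : divides q a -> divides q b -> divides q (a - b).
Proof. by move=> [c ->] [c' ->]; exists (c - c'); rewrite mulrBl. Qed.

Lemma divides_trans a b u : divides a b -> divides b u -> divides a u.
Proof. by move=> ab [c ->]; apply: dividesMl. Qed.

Lemma divides_sum q (I : Type) (s : seq I) (P : pred I) (F : I -> A) :
  (forall i, P i -> divides q (F i)) -> divides q (\sum_(i <- s | P i) F i).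
Proof. by move=> qF; elim/big_ind: _ => //; [apply: divides0|apply: dividesD]. Qed.

(** Primality replaces irreducibility, so factorizations into such elements are automatically
    unique. *)
Definition prime_elt q : Prop :=
  [/\ q != 0, ~ divides q 1 &
      forall a b, divides q (a * b) -> divides q a \/ divides q b].

Lemma prime_elt_prod q (s : seq A) :
  prime_elt q -> divides q (\prod_(x <- s) x) -> exists2 x, x \in s & divides q x.
Proof.
move=> [_ q1 qM]; elim: s => [|x s IH]; first by rewrite big_nil => /q1.
rewrite big_cons => /qM[qx|/IH[z zs qz]]; first by exists x; rewrite ?mem_head.
by exists z; rewrite // inE zs orbT.
Qed.

End Divides.

Section PrimeFactorization.
Variable A : idomainType.
Implicit Types (a b q u p : A) (s t : seq A).

Definition factorization a u s : Prop :=
  [/\ u \is a GRing.unit, forall q, q \in s -> prime_elt q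
    & a = u * \prod_(q <- s) q].

Definition factorizable a : Prop := exists u s, factorization a u s.

Lemma factorizable_unit u : u \is a GRing.unit -> factorizable u.
Proof. by move=> uU; exists u, [::]; split; rewrite // big_nil mulr1. Qed.

Lemma factorizable_prime q : prime_elt q -> factorizable q.
Proof.
move=> qP; exists 1, [:: q]; split; rewrite ?unitr1 ?big_seq1 ?mul1r //.
by move=> x; rewrite inE => /eqP->.
Qed.

Lemma factorizableM a b : factorizable a -> factorizable b -> factorizable (a * b).
Proof.
move=> [u [s [uU sP ->]]] [v [t [vU tP ->]]]; exists (u * v), (s ++ t).
split; rewrite ?unitrM ?uU //; last by rewrite big_cat /= mulrACA.
by move=> q; rewrite mem_cat => /orP[/sP|/tP].
Qed.

Lemma factorizable_prod (I : eqType) (r : seq I) (F : I -> A) :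
  (forall i, i \in r -> factorizable (F i)) -> factorizable (\prod_(i <- r) F i).
Proof.
move=> FP; rewrite big_seq; elim/big_ind: _ => //; last exact: factorizableM.
by apply: factorizable_unit; rewrite unitr1.
Qed.

(** The head prime [x] of the list divides [q * b]. If it divides [q], the two are associates and
    [x] is dropped; otherwise it is cancelled from [b] and the induction goes on. The drop in length
    makes repeated extraction of primes terminate. *)
Lemma factorization_cancel_prime q b u s :
  prime_elt q -> factorization (q * b) u s ->
  exists u' t, factorization b u' t /\ (size t < size s)%N.
Proof.
move=> qP; have [q0 q1 qM] := qP; elim: s b => [|x s IH] b [uU sP].
  rewrite big_nil mulr1 => qb; case: q1; exists (b / u).
  by rewrite mulrAC (mulrC b) qb divrr.
rewrite big_cons mulrCA => qb.
have xP : prime_elt x by apply: sP; rewrite mem_head.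
have [x0 x1 xM] := xP.
have sP' z : z \in s -> prime_elt z by move=> zs; apply: sP; rewrite inE zs orbT.
have /xM[[w qE]|[b' bE]] : divides x (q * b) by rewrite qb mulrC; eexists.
- have [[v xE]|[v wE]] : divides q x \/ divides q w.
    by apply: qM; exists 1; rewrite mul1r mulrC.
  + have wv : w * v = 1.
      by apply: (mulIf q0); rewrite -mulrA -xE mul1r.
    have wU : w \is a GRing.unit by apply/unitrPr; exists v.
    exists (w^-1 * u), s; split=> //; split=> //; first by rewrite unitrM unitrV wU.
    apply: (mulrI wU); rewrite -!mulrA mulVKr //.
    by apply: (mulfI x0); rewrite -qb {1}qE; ring.
  + case: x1; exists v; apply: (mulfI q0).
    by rewrite mulr1 {1}qE wE; ring.
- have /IH[u' [t [[u'U tP b'E] st]]] : factorization (q * b') u s.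
    by split=> //; apply: (mulfI x0); rewrite -qb bE; ring.
  exists u', (x :: t); split=> //; split=> //.
    by move=> z; rewrite inE => /orP[/eqP->|/tP].
  by rewrite big_cons bE b'E; ring.
Qed.

(** Each listed prime divides a multiple [w * p] but not [p], hence divides [w] and cancels; [p]
    itself may be composite. *)
Lemma divides_cancel_primes p a u s :
  u \is a GRing.unit -> (forall q, q \in s -> prime_elt q) ->
  (forall q, q \in s -> ~ divides q p) ->
  divides p (u * \prod_(q <- s) q * a) -> divides p a.
Proof.
move=> uU; elim: s a => [|q s IH] a sP sp.
  by rewrite big_nil mulr1 => -[w e]; exists (u^-1 * w); rewrite -mulrA -e mulKr.
have [q0 q1 qM] : prime_elt q by apply: sP; rewrite mem_head.
rewrite big_cons => -[w e]; have /qM[[w' wE]|/sp] : divides q (w * p).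
- by rewrite -e; exists (u * \prod_(j <- s) j * a); ring.
- apply: IH => [z zs|z zs|]; [apply: sP|apply: sp|]; rewrite ?inE ?zs ?orbT //.
  by exists w'; apply: (mulfI q0); transitivity (w * p); [rewrite -e | rewrite wE]; ring.
- by rewrite mem_head => /(_ isT).
Qed.

Lemma divides_coprimeM a b c : factorizable a -> divides a c -> divides b c ->
  (forall q, prime_elt q -> divides q a -> divides q b -> False) ->
  divides (a * b) c.
Proof.
move=> [u [s [uU sP ->]]] [c' ->] bc cop.
have : divides b c'.
  apply: (divides_cancel_primes uU sP) (_ : divides _ (_ * c')).
    move=> q qs; apply: cop (sP q qs) _.
    by rewrite (perm_big _ (perm_to_rem qs)) big_cons mulrCA; eexists; apply: mulrC.
  by rewrite mulrC.
by case=> w ->; exists w; ring.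
Qed.

Lemma divides_coprime_prod (I : eqType) (r : seq I) (F : I -> A) c :
  uniq r -> (forall i, i \in r -> factorizable (F i)) ->
  (forall i, i \in r -> divides (F i) c) ->
  (forall i j q, i \in r -> j \in r -> i != j -> prime_elt q ->
     divides q (F i) -> divides q (F j) -> False) ->
  divides (\prod_(i <- r) F i) c.
Proof.
elim: r => [|i r IH]; first by exists c; rewrite big_nil mulr1.
move=> /= /andP[ir Ur] FP Fc cop; rewrite big_cons.
have sub j : j \in r -> j \in i :: r by rewrite inE orbC => ->.
apply: divides_coprimeM; [exact/FP/mem_head|exact/Fc/mem_head| |].
  apply: IH => // [j /sub/FP//|j /sub/Fc//|j l q /sub jr /sub lr]; exact: cop.
move=> q qP qi; rewrite -(big_map F xpredT id) => /(prime_elt_prod qP)[x].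
case/mapP=> j jr -> qj; apply: (cop i j q) => //; rewrite ?mem_head ?sub //.
by apply: contraNneq ir => ->.
Qed.

End PrimeFactorization.

Lemma unitr_neq0 (A : unitRingType) (u : A) : u \is a GRing.unit -> u != 0.
Proof. by apply: contraTneq => ->; rewrite unitr0. Qed.

Definition factorial_domain (A : idomainType) : Prop :=
  forall a : A, a != 0 -> factorizable a.

(** * Gauss's lemma and factoriality of univariate polynomial rings *)

Section GaussLemma.
Import Pdiv.IdomainDefs Pdiv.WeakIdomain Pdiv.CommonIdomain.
Variable A : idomainType.
Implicit Types (c q : A) (a b p g w : {poly A}).

Lemma divides_polyC q p : divides q%:P p -> forall i, divides q p`_i.
Proof. by case=> w -> i; rewrite coefMC; eexists. Qed.

(** If [q] divides [a * b], it divides the product of the leading coefficients, hence one of them;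
    removing that leading term with [tl] leaves a smaller product still divisible by [q]. *)
Lemma prime_polyC q : prime_elt q -> prime_elt q%:P.
Proof.
move=> [q0 q1 qM]; split; first by rewrite polyC_eq0.
  by move=> /divides_polyC/(_ 0%N); rewrite coef1.
pose tl p := p - lead_coef p *: 'X^((size p).-1).
have size_tl p : p != 0 -> (size (tl p) < size p)%N.
  move=> p0; rewrite (polySpred p0) ltnS; apply/leq_sizeP => j.
  rewrite leq_eqVlt coefB coefZ coefXn => /orP[/eqP<-|lt].
    by rewrite eqxx mulr1 subrr.
  by rewrite gtn_eqF // mulr0 subr0 nth_default // (polySpred p0).
have tlE p : p = tl p + lead_coef p *: 'X^((size p).-1) by rewrite subrK.
have tl_dvd p : divides q (lead_coef p) -> divides q%:P (lead_coef p *: 'X^((size p).-1)).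
  by case=> c ->; exists (c *: 'X^((size p).-1)); rewrite -mul_polyC -mul_polyC polyCM; ring.
move=> a b; move: {2}(size a + size b)%N (leqnn (size a + size b)) => n.
elim: n a b => [|n IH] a b.
  by rewrite leqn0 addn_eq0 size_poly_eq0 => /andP[/eqP-> _] _; left; apply: divides0.
move=> le ab; have [->|a0] := eqVneq a 0; first by left; apply: divides0.
have [->|b0] := eqVneq b 0; first by right; apply: divides0.
have /qM[qa|qb] : divides q (lead_coef a * lead_coef b).
  by rewrite -lead_coefM; apply: divides_polyC.
- have lt : (size (tl a) + size b <= n)%N by rewrite -ltnS (leq_trans _ le) // ltn_add2r size_tl.
  case: (IH _ _ lt); [|by left; rewrite [a]tlE; apply/dividesD/tl_dvd|by right].
  by rewrite mulrBl; apply: dividesB => //; apply/dividesMr/tl_dvd.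
- have lt : (size a + size (tl b) <= n)%N by rewrite -ltnS (leq_trans _ le) // ltn_add2l size_tl.
  case: (IH _ _ lt); [|by left|by right; rewrite [b]tlE; apply/dividesD/tl_dvd].
  by rewrite mulrBr; apply: dividesB => //; apply/dividesMl/tl_dvd.
Qed.

Definition primitive_poly p : Prop := forall q, prime_elt q -> ~ divides q%:P p.

Hypothesis A_ufd : factorial_domain A.

Lemma factorizable_polyC c : c != 0 -> factorizable c%:P.
Proof.
move=> /A_ufd[u [s [uU sP ->]]]; rewrite polyCM; apply: factorizableM.
  by apply: factorizable_unit; rewrite poly_unitE size_polyC coefC eqxx uU unitr_neq0.
rewrite rmorph_prod /=; apply: factorizable_prod => q /sP/prime_polyC.
exact: factorizable_prime.
Qed.

(** A prime of [A] dividing [p] divides its leading coefficient, and extracting it shortens the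
    factorization of that coefficient, so the extraction stops. *)
Lemma primitive_part p : p != 0 ->
  exists c p0, [/\ c != 0, p = c%:P * p0 & primitive_poly p0].
Proof.
move=> p0; have: factorizable (lead_coef p) by apply: A_ufd; rewrite lead_coef_eq0.
case=> u [s us]; move: {2}(size s).+1 (ltnSn (size s)) => n.
elim: n => // n IH in p p0 u s us * => lt.
have [prim|] := pselect (primitive_poly p).
  by exists 1, p; rewrite oner_neq0 mul1r.
move=> /existsNP[q /not_implyP[qP /contrapT[p1 pE]]].
have [q0 _ _] := qP.
have p1_neq0 : p1 != 0 by apply: contraNneq p0 => p10; rewrite pE p10 mul0r.
have us1 : factorization (q * lead_coef p1) u s.
  by move: us; rewrite pE lead_coefM lead_coefC mulrC.
have [u' [t [ut lt_ts]]] := factorization_cancel_prime qP us1.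
have [c [r [c0 p1E prim]]] := IH p1 p1_neq0 u' t ut (leq_trans lt_ts lt).
by exists (c * q), r; split; rewrite ?mulf_neq0 // pE p1E polyCM; ring.
Qed.

(** Primes of [c] stay prime in [{poly A}], so each divides [w] or [g] and cancels there without
    changing sizes. This turns a factorization over the fraction field into one over [A]. *)
Lemma split_constant_factor c p w g : c != 0 -> c%:P * p = w * g ->
  exists w' g', [/\ p = w' * g', size w' = size w & size g' = size g].
Proof.
move=> /A_ufd[u [s [uU sP ->]]].
have u0 := unitr_neq0 uU.
elim: s w g sP => [|q s IH] w g sP; rewrite ?big_nil ?big_cons.
  rewrite mulr1 => e; exists (u^-1 *: w), g; split=> //.
    rewrite -mul_polyC -mulrA -e mulrA -polyCM mulVr // mul1r //.
  by rewrite size_scale // invr_eq0.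
have qP := sP q (mem_head _ _).
have [q0 _ _] := qP.
have [_ _ qM] := prime_polyC qP => e.
have {}sP z : z \in s -> prime_elt z by move=> zs; apply: sP; rewrite inE zs orbT.
have /qM[[w1 wE]|[g1 gE]] : divides q%:P (w * g).
- by rewrite -e !polyCM; exists (u%:P * (\prod_(j <- s) j)%:P * p); ring.
- have [w' [g' [pE sw sg]]] : exists w' g', [/\ p = w' * g', size w' = size w1 & size g' = size g].
    apply: IH => //; apply: (@mulfI _ q%:P); rewrite ?polyC_eq0 //.
    by transitivity (w * g); [rewrite -e !polyCM | rewrite wE]; ring.
  by exists w', g'; split=> //; rewrite sw wE mulrC mul_polyC size_scale.
- have [w' [g' [pE sw sg]]] : exists w' g', [/\ p = w' * g', size w' = size w & size g' = size g1].
    apply: IH => //; apply: (@mulfI _ q%:P); rewrite ?polyC_eq0 //.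
    by transitivity (w * g); [rewrite -e !polyCM | rewrite gE]; ring.
  by exists w', g'; split=> //; rewrite sg gE mulrC mul_polyC size_scale.
Qed.

(** Here [%|] is pseudo-divisibility: [p] divides a nonzero constant multiple of [a]. No prime of
    that constant divides the primitive [p], so the constant cancels. *)
Lemma primitive_dvdp p a : primitive_poly p -> p %| a -> divides p a.
Proof.
move=> prim /dvdpP[[c w] /= /A_ufd[u [s [uU sP ->]]] e].
have : divides p ((u%:P * \prod_(q <- [seq q%:P | q <- s]) q) * a).
  by exists w; rewrite -e -mul_polyC polyCM rmorph_prod big_map.
apply: divides_cancel_primes.
- by rewrite poly_unitE size_polyC coefC eqxx uU unitr_neq0.
- by move=> _ /mapP[q /sP qP ->]; apply: prime_polyC.
- by move=> _ /mapP[q /sP qP ->]; apply: prim.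
Qed.

Lemma primitive_irreducible_prime p : (1 < size p)%N -> primitive_poly p ->
  (forall a b, p = a * b -> (size a <= 1)%N \/ (size b <= 1)%N) -> prime_elt p.
Proof.
move=> p1 prim irr; have p0 : p != 0 by rewrite -size_poly_gt0 ltnW.
split=> // [[w e]|a b [w e]].
  have w0 : w != 0 by apply: contra_eqN e => /eqP->; rewrite mul0r oner_neq0.
  have := congr1 (fun r : {poly A} => size r) e.
  by rewrite size_mul // size_poly1 (polySpred w0); lia.
have pab : p %| a * b by apply/dvdpP; exists (1, w); rewrite ?oner_neq0 ?scale1r.
have g0 : gcdp p a != 0 by rewrite gcdp_eq0 negb_and p0.
(* The pseudo-gcd yields a true factor [g'] of [p] of the same size. Either it has full size and [p]
   divides [a], or it is constant and [p], coprime to [a], divides [b]. *)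
have /dvdpP[[c r] /= c0] := dvdp_gcdl p a.
rewrite -mul_polyC => cE.
have [r' [g' [pE sr sg]]] := split_constant_factor c0 cE.
have r'0 : r' != 0 by apply: contraNneq p0 => r0; rewrite pE r0 mul0r.
have g'0 : g' != 0 by apply: contraNneq p0 => r0; rewrite pE r0 mulr0.
have [le1|le1] := irr _ _ pE; [left|right]; apply: primitive_dvdp => //.
  have sgp : size (gcdp p a) = size p.
    have r1 : size r' = 1%N by apply/eqP; rewrite eqn_leq le1 size_poly_gt0.
    by rewrite [in RHS]pE size_mul // sg r1.
  have := dvdp_size_eqp (dvdp_gcdl p a).
  rewrite sgp eqxx => /esym/eqp_dvdl <-.
  exact: dvdp_gcdr.
rewrite -(@Gauss_dvdpr _ b a p) //.
by rewrite coprimep_def eqn_leq -{1}sg le1 size_poly_gt0.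
Qed.

(** Induction on the size: the primitive part is constant, prime, or a product of two nonconstant
    factors, both of smaller size. *)
Lemma factorial_poly : factorial_domain {poly A}.
Proof.
move=> p; move: {2}(size p) (leqnn (size p)) => n.
elim: n p => [|n IH] p; first by rewrite leqn0 size_poly_eq0 => ->.
move=> sp p0; have [c [r [c0 pE prim]]] := primitive_part p0.
have r0 : r != 0 by apply: contraNneq p0 => r0; rewrite pE r0 mulr0.
have sr : (size r <= n.+1)%N by move: sp; rewrite pE mul_polyC size_scale.
 rewrite pE; apply: factorizableM; first exact: factorizable_polyC.
have [r1|r1] := leqP (size r) 1.
  rewrite (size1_polyC r1) in r0 *; apply: factorizable_polyC.
  by rewrite -polyC_eq0.
have [irr|] := pselect (forall a b, r = a * b -> (size a <= 1)%N \/ (size b <= 1)%N).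
  exact/factorizable_prime/primitive_irreducible_prime.
move=> /existsNP[a /existsNP[b /not_implyP[rE /not_orP[/negP a1 /negP b1]]]].
have a0 : a != 0 by apply: contraNneq r0 => a0; rewrite rE a0 mul0r.
have b0 : b != 0 by apply: contraNneq r0 => b0; rewrite rE b0 mulr0.
move: sr; rewrite rE size_mul // => sr.
by apply: factorizableM; apply: IH => //; lia.
Qed.

End GaussLemma.

Lemma factorial_domain_bij (A B : idomainType) (f : {rmorphism A -> B}) :
  bijective f -> factorial_domain B -> factorial_domain A.
Proof.
move=> [g fK gK] Bufd a a0.
have f_dvd q b : divides q b <-> divides (f q) (f b).
  split=> [[c ->]|[c e]]; first by exists (f c); rewrite rmorphM.
  by exists (g c); apply: (can_inj fK); rewrite rmorphM gK.
have [|u [s [uU sP aE]]] := Bufd (f a).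
  by rewrite -(rmorph0 f) (inj_eq (can_inj fK)).
exists (g u), (map g s); split.
- by apply/unitrP; exists (g u^-1); split; apply: (can_inj fK);
    rewrite rmorphM !gK rmorph1 ?mulVr ?divrr.
- move=> _ /mapP[q /sP[q0 q1 qM] ->]; split.
  + by apply: contraNneq q0 => gq; rewrite -[q]gK gq rmorph0.
  + by rewrite f_dvd gK rmorph1.
  + by move=> b c; rewrite !f_dvd gK rmorphM; apply: qM.
- apply: (can_inj fK); rewrite aE rmorphM gK big_map rmorph_prod.
  by congr (_ * _); apply: eq_bigr => q _; rewrite gK.
Qed.

(** * Factoriality of multivariate polynomial rings *)

Section MpolyFactorial.
Variable k : fieldType.

(** Splitting off the last exponent recovers every coefficient of [p] from [muni p], whence
    injectivity. *)
Lemma muni_coef n (p : {mpoly k[n.+1]}) (m : 'X_{1..n.+1}) :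
  ((muni p)`_(m ord_max))@_[multinom m (widen_ord (leqnSn n) i) | i < n] = p@_m.
Proof.
rewrite muniE coef_sum raddf_sum /= [in RHS](mpolyE p) raddf_sum /=.
apply: eq_bigr => m' _; rewrite coefZ coefXn mcoeffZ mcoeffX.
have [->|m'm] := eqVneq m' m.
  by rewrite eqxx mulr1 mcoeffZ mcoeffX eqxx.
rewrite mulr0; case: eqP => [em|]; last by rewrite mulr0 mcoeff0.
rewrite mulr1 mcoeffZ mcoeffX; case: eqP => [e|]; last by rewrite mulr0.
case/eqP: m'm; apply/mnmP => i; case: (unliftP ord_max i) => [j ->|->//].
have -> : lift ord_max j = widen_ord (leqnSn n) j.
  by apply: val_inj; rewrite /= /bump leqNgt ltn_ord.
by have := congr1 (fun t : 'X_{1..n} => t j) e; rewrite !mnmE.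
Qed.

Lemma muni_inj n : injective (@muni n k).
Proof. by move=> p q e; apply/mpolyP => m; rewrite -!muni_coef e. Qed.

Lemma muni_mwiden n (p : {mpoly k[n]}) : muni (mwiden p) = p%:P.
Proof.
elim/mpolyind: p => [|c m p _ _ IH]; first by rewrite mwiden0 muni0.
rewrite mwidenD muniD IH polyCD; congr (_ + _).
rewrite mwidenZ mwidenX muniZ -mul_polyC -mul_mpolyC polyCM; congr (_ * _).
rewrite muniE msuppX big_seq1 mcoeffX eqxx mnmwiden_ordmax expr0 alg_polyC scale1r.
by congr (_%:P); congr 'X_[_]; apply/mnmP=> i; rewrite mnmE mnmwiden_widen.
Qed.

Lemma muni_bij n : bijective (@muni n k).
Proof.
have surj (q : {poly {mpoly k[n]}}) : muni (mmulti q) = q.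
  rewrite /mmulti raddf_sum -[in RHS](coefK q) poly_def; apply: eq_bigr => i _ /=.
  rewrite rmorphM rmorphXn /= muni_mwiden -mul_polyC; congr (_ * _ ^+ _).
  rewrite muniE msuppX big_seq1 mcoeffX eqxx mnm1E eqxx expr1 scale1r.
  rewrite (_ : [multinom _ | _ < _] = 0%MM) ?mpolyX0 ?scale1r //.
  by apply/mnmP => j; rewrite mnmE mnm1E mnm0E -val_eqE /= gtn_eqF.
by exists (@mmulti n k) => // p; apply: muni_inj; rewrite surj.
Qed.

Lemma factorial_mpoly n : factorial_domain {mpoly k[n]}.
Proof.
elim: n => [|n IH]; last exact: factorial_domain_bij (muni_bij n) (factorial_poly IH).
(* Without variables a nonzero polynomial is a nonzero constant, hence a unit. *)
move=> p p0; apply: factorizable_unit.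
have pE := nvar0_mpolyC p; have c0 : p@_0%MM != 0.
  by apply: contraNneq p0 => c0; rewrite pE c0.
by apply/unitrP; exists (p@_0%MM)^-1%:MP; rewrite {2 3}pE -!mpolyCM mulVf ?mulfV.
Qed.
End MpolyFactorial.

(** * Determinants and homogeneous polynomials *)

Section Determinants.
Variable A : comNzRingType.

Lemma divides_detB n (h : A) (M N : 'M[A]_n) :
  (forall i j, divides h (M i j - N i j)) -> divides h (\det M - \det N).
Proof.
move=> MN; rewrite -sumrB; apply: divides_sum => s _; rewrite -mulrBr.
apply: dividesMl; move: (index_enum _) => r.
elim: r => [|i r IH]; first by rewrite !big_nil subrr; apply: divides0.
rewrite !big_cons.
(* A difference of products telescopes: change the first factor, then the others. *)
rewrite (_ : _ - _ = (M i (s i) - N i (s i)) * \prod_(j <- r) M j (s j)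
   + N i (s i) * (\prod_(j <- r) M j (s j) - \prod_(j <- r) N j (s j))); last by ring.
by apply: dividesD; [apply: dividesMr|apply: dividesMl].
Qed.

(** The matrix is a 3x2 matrix times a 2x3 one; [sel] pads both with zeros to square matrices, so
    that the determinant is multiplicative. *)
Lemma det3_rank2 (c g u v : 'I_3 -> A) :
  \det (\matrix_(i, j) (c i * u j + g i * v j)) = 0.
Proof.
pose sel (a b : A) (l : 'I_3) := if l == 0 then a else if l == 1 then b else 0.
rewrite (_ : \matrix_(_, _) _ = (\matrix_(i, l) sel (c i) (g i) l) *m
  (\matrix_(l, j) sel (u j) (v j) l)).
  by rewrite det_mulmx (expand_det_col _ ord_max) big1 ?mul0r // => i _; rewrite !mxE mul0r.
apply/matrixP => i j; rewrite !mxE !big_ord_recl big_ord0 !mxE /sel /=.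
by rewrite mulr0 !addr0.
Qed.

(* Expand the determinant of M with its column j repeated in front. *)
Lemma signed_minors_orthogonal n (M : 'M[A]_(n.+1, n)) j :
  \sum_(i < n.+1) (-1) ^+ i * \det (row' i M) * M i j = 0.
Proof.
pose N : 'M[A]_(1 + n)%N := row_mx (col j M) M.
transitivity (\det N); last first.
  rewrite -det_tr; apply: (@determinant_alternate _ _ _ (lshift n 0) (rshift 1 j)) => //.
  by move=> i; rewrite !mxE (unsplitK (inl _)) (unsplitK (inr _)) mxE.
rewrite (expand_det_col _ (lshift n 0)); apply: eq_bigr => i _.
rewrite mxE (unsplitK (inl _)) mxE mulrC; congr (_ * _).
rewrite /cofactor /= addn0; congr (_ * \det _).
apply/matrixP => a b; rewrite !mxE.
have -> : @lift (1 + n) (lshift n 0) b = rshift 1 b by apply: val_inj.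
by rewrite (unsplitK (inr _)).
Qed.

(** The selection [s], injective or not, misses some row [i], so the submatrix is [row' i M]
    multiplied on both sides by 0-1 matrices. *)
Lemma mxsub_det_neq0 n (M : 'M[A]_(n.+1, n)) (s : 'I_n -> 'I_n.+1) (t : 'I_n -> 'I_n) :
  \det (mxsub s t M) != 0 -> exists i, \det (row' i M) != 0.
Proof.
have [i is'] : exists i, i \notin codom s.
  apply/existsP; rewrite -negb_forall; apply/negP => /forallP all_s.
  have : (#|'I_n.+1| <= #|codom s|)%N by apply/subset_leq_card/subsetP.
  by rewrite card_ord leqNgt ltnS (leq_trans (card_size _)) // size_codom card_ord.
move=> st0; exists i; apply: contraNneq st0 => M0.
(* The default [l] is never taken, since [s l] is never [i]. *)
pose r l := odflt l (unlift i (s l)).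
have -> : mxsub s t M = (\matrix_(a, b) (r a == b)%:R) *m
    (row' i M *m (\matrix_(a, b) (a == t b)%:R)).
  apply/matrixP => a b; rewrite !mxE (bigD1 (r a)) //= big1 => [|l ne].
    rewrite !mxE eqxx mul1r addr0 (bigD1 (t b)) //= big1 => [|l ne].
      rewrite !mxE eqxx mulr1 addr0 /r; case: unliftP => [l ->|e] //.
      by rewrite -e codom_f in is'.
    by rewrite !mxE (negbTE ne) mulr0.
  by rewrite !mxE eq_sym (negbTE ne) mul0r.
by rewrite !det_mulmx M0 mul0r mulr0.
Qed.

End Determinants.

(** * Degrees, Euler's formula and homogeneous components *)

Section Mpoly.
Variables (k : fieldType) (n : nat).
Local Notation S := {mpoly k[n]}.

Lemma mpoly_nonunit_msize (q : S) : q != 0 -> ~ divides q 1 -> (1 < msize q)%N.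
Proof.
move=> q0 q1; rewrite ltnNge; apply/negP => /msize1_polyC qE.
apply: q1; exists (q@_0%MM)^-1%:MP; rewrite {2}qE -mpolyCM mulVf //.
by apply: contraNneq q0 => c0; rewrite qE c0.
Qed.

Lemma mpoly_Euler d (p : S) :
  p \is d.-homog -> \sum_j 'X_j * p^`M(j) = d%:R *: p.
Proof.
move=> /dhomogP pd; rewrite [in RHS](mpolyE p) scaler_sumr.
under eq_bigr => j _ do rewrite /mderiv mulr_sumr.
rewrite exchange_big; apply: eq_big_seq => m /pd <- /=.
rewrite mdegE natr_sum scaler_suml; apply: eq_bigr => j _.
rewrite -scalerAr scalerA; have [->|mj] := eqVneq (m j) 0%N; first by rewrite !mul0r !scale0r.
by rewrite -mpolyXD addmC submK // lep1mP.
Qed.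

Lemma mderiv_dhomog d (p : S) i :
  p \is d.-homog -> p^`M(i) \is (d.-1).-homog.
Proof.
move=> /dhomogP pd; rewrite /mderiv big_seq; apply: rpred_sum => m /pd /= md.
have [->|mi] := eqVneq (m i) 0%N; first by rewrite mul0r scale0r dhomog0.
rewrite dhomogZ // dhomogX -md -[in X in _ == X](submK (m := U_(i)) (m' := m)) ?lep1mP //.
by rewrite [mdeg (_ + _)]mdegD mdeg1 addn1.
Qed.

Lemma dhomog_det m e (M : 'M[S]_m) :
  (forall i j, M i j \is e.-homog) -> \det M \is (m * e).-homog.
Proof.
move=> Me; apply: rpred_sum => s _; rewrite rpredMsign.
suff prodP (r : seq 'I_m) : \prod_(i <- r) M i (s i) \is (size r * e).-homog.
  by have := prodP (index_enum 'I_m); rewrite /index_enum -enumT size_enum_ord.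
elim: r => [|i r IH]; first by rewrite big_nil dhomog1.
by rewrite big_cons dhomogM.
Qed.

Lemma pihomog_dhomogM D e (a b : S) : a \is D.-homog ->
  pihomog mdeg (D + e) (a * b) = a * pihomog mdeg e b.
Proof.
move=> aD; rewrite {1}(pihomog_partitionE (leqnn (mmeasure mdeg b))).
rewrite mulr_sumr raddf_sum /=.
under eq_bigr => i _.
  have -> : pihomog mdeg (D + e) (a * pihomog mdeg i b) =
            if i == e :> nat then a * pihomog mdeg e b else 0.
    have hom := dhomogM aD (pihomogP mdeg i b).
    case: eqP => [<-|/eqP ne]; first by rewrite pihomog_dE.
    by rewrite (pihomog_ne0 _ hom) // eqn_add2l.
  over.
rewrite -big_mkcond /=; have [lt|le] := ltnP e (mmeasure mdeg b).
  by rewrite (big_pred1 (Ordinal lt)).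
rewrite big_pred0 => [|i]; last by rewrite ltn_eqF // (leq_trans _ le).
suff -> : pihomog mdeg e b = 0 by rewrite mulr0.
rewrite pihomogE big_seq_cond big_pred0 // => m.
by apply/negP => /andP[mb /eqP me]; have := mmeasure_mnm_lt mdeg mb; rewrite me ltnNge le.
Qed.

(** Components of [b] in degrees [e] with [D + e != N] are annihilated by [a], hence vanish in a
    domain; if [N < D], all of them do. *)
Lemma dhomog_cofactor D N (a b : S) : a \is D.-homog -> a * b \is N.-homog ->
  a * b != 0 -> (D <= N)%N /\ b \is (N - D).-homog.
Proof.
move=> aD abN; rewrite mulf_eq0 => /norP[a0 b0].
have b_e e : (D + e)%N != N -> pihomog mdeg e b = 0.
  move=> ne; apply: (mulfI a0); rewrite mulr0 -(pihomog_dhomogM e b aD).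
  by rewrite (pihomog_ne0 _ abN) // eq_sym.
have [le|lt] := leqP D N.
  split=> //; have := pihomog_dhomogM (N - D) b aD.
  by rewrite subnKC // pihomog_dE // => /(mulfI a0) {1}->; apply: pihomogP.
case/eqP: b0; rewrite (pihomog_partitionE (leqnn (mmeasure mdeg b))) big1 // => e _.
by rewrite b_e // gtn_eqF // (leq_trans lt) ?leq_addr.
Qed.

End Mpoly.

(** * Ideals and fibers *)

Section Ideals.
Variable A : comNzRingType.

Definition principal_ideal (q : A) : {pred A} := [pred u | `[< divides q u >]].

Lemma principal_idealP (q u : A) : reflect (divides q u) (u \in principal_ideal q).
Proof. exact: asboolP. Qed.

Lemma prime_principal_ideal (q : A) : prime_elt q -> prime_ideal (principal_ideal q).
Proof.
move=> [q0 q1 qM]; split.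
  split; [exact/principal_idealP/divides0|exact/principal_idealP|].
  move=> a u v /principal_idealP qu /principal_idealP qv.
  by apply/principal_idealP/dividesD => //; apply: dividesMl.
by move=> u v /principal_idealP/qM[] /principal_idealP ->; rewrite ?orbT.
Qed.

Lemma idealr_closedMl (P : {pred A}) a u : idealr_closed P -> u \in P -> a * u \in P.
Proof. by move=> [P0 _ PD] uP; rewrite -[_ * _]addr0 PD. Qed.

(** Otherwise pick an element of each [Q i] outside [P]: their product lies in every [Q i], hence in
    the prime [P]. *)
Lemma prime_ideal_contains_factor (P : {pred A}) (I : finType) (Q : I -> {pred A}) :
  prime_ideal P -> (forall i, idealr_closed (Q i)) ->
  (forall u, (forall i, u \in Q i) -> u \in P) ->
  exists i, {subset Q i <= P}.
Proof.
move=> [[P0 P1 PD] PM] Qid QP; apply: contrapT => /forallNP noQ.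
have /choice[v vP] i : exists v, v \in Q i /\ v \notin P.
  apply: contrapT => /forallNP nov; apply: (noQ i) => u uQ.
  by apply: contrapT => /negP uP; apply: (nov u).
have : \prod_i v i \in P.
  apply: QP => i; rewrite (bigD1 i) //= mulrC; apply: idealr_closedMl (Qid i) _.
  by case: (vP i).
apply/negP; elim/big_rec: _ => // i x _ xP; apply/negP => /PM /orP[|]; last exact/negP.
by apply/negP; case: (vP i).
Qed.

End Ideals.

(* In a domain with a degree, (q) has height one: a nonzero element of minimal
   degree in a prime strictly between 0 and (q) could be divided by q. *)
Lemma principal_height (k : fieldType) n (q : {mpoly k[n]}) :
  prime_elt q -> ~ height_ge (principal_ideal q) 2.
Proof.
move=> [q0 q1 qM] [C [Cprime Cstep] Cq].
have [C01 nC10] := Cstep 0%N isT; have [C12 nC21] := Cstep 1%N isT.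
have [[C0_0 _ _] _] := Cprime 0%N isT.
have [C1id C1M] := Cprime 1%N isT.
have qC1 : q \notin C 1%N.
  apply/negP => qC; apply: nC21 => u; rewrite Cq => /principal_idealP[c ->].
  exact: idealr_closedMl.
suff C1_0 N u : (msize u <= N)%N -> u \in C 1%N -> u = 0.
  by apply: nC10 => u uC; rewrite (C1_0 _ u (leqnn _) uC).
elim: N u => [|N IH] u uN uC; first by apply/eqP; rewrite -msize_poly_eq0 -leqn0.
have [c uE] : divides q u by apply/principal_idealP; rewrite -Cq C12.
apply: contrapT => /eqP u0.
have c0 : c != 0 by apply: contraNneq u0 => c0; rewrite uE c0 mul0r.
move: uC; rewrite uE => /C1M; rewrite (negbTE qC1) orbF => /IH e.
case/eqP: (c0); apply: e.
have := mpoly_nonunit_msize q0 q1; move: uN; rewrite uE msizeM //.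
by case: (msize q) => [|[|e]] //; rewrite !addnS ltnS => /(leq_trans (leq_addr _ _)).
Qed.

Section UnmixedPart.
Variables (k : fieldType) (n : nat).
Local Notation S := {mpoly k[n]}.

Lemma Proj_chain_sub (a b : {pred S}) m :
  {subset a <= b} -> Proj_chain b m -> Proj_chain a m.
Proof. by move=> ab [C [Cc Ch bC Cn]]; exists C; split=> // u /ab/bC. Qed.

Lemma unmixed_part_mem (a : {pred S}) m h u :
  defines_unmixed_part a m h -> u \in a -> divides h u.
Proof.
move=> [_ [s [Q [[_ aE _ _] hE]]]]; rewrite aE => /forallP uQ.
by apply/hE => i _; apply: uQ.
Qed.

(** The bottom prime of a chain of length [m] over [a] contains a component [Q i], which therefore
    has dimension [m]; were [h] a unit, [1] would lie in [Q i]. *)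
Lemma unmixed_part_nonunit (a : {pred S}) m h :
  defines_unmixed_part a m h -> Proj_dim a m -> ~ divides h 1.
Proof.
move=> [_ [s [Q [[Qprim aE _ _] hE]]]] [[C [Cc Ch aC Cn]] nch] h1.
have Qid i : idealr_closed (Q i) by case: (Qprim i) => -[].
have aQ i : {subset a <= Q i} by move=> u; rewrite aE => /forallP.
have [|i QC] := @prime_ideal_contains_factor _ (C 0%N) _ Q (Cc.1 0%N (leq0n _)) Qid.
  by move=> u uQ; apply: aC; rewrite aE; apply/forallP.
have [_ /negP Q1 _] := Qid i; apply: Q1; apply: (hE 1).1 => //; split; first by exists C.
by move=> /(Proj_chain_sub (aQ i)).
Qed.

End UnmixedPart.

Section ProjPoints.
Variables (k : fieldType) (n : nat).
Implicit Types y : proj_point k n.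

Lemma hcoord_neq0 y : exists i, hcoord y i != 0.
Proof.
apply: contrapT => /forallNP y0; have := svalP y; rewrite /= -[sval y]/(val y).
suff /eqP -> : val y == 0%VS by rewrite dimv0.
rewrite -vpick0; apply/eqP/rowP => i; rewrite mxE; apply/eqP.
by apply: contrapT => /negP; apply: y0.
Qed.

Lemma proj_point_line y : val y = <[vpick (val y)]>%VS.
Proof.
apply/esym/eqP; rewrite eqEdim -memvE memv_pick dim_vline.
have /eqP dy : \dim (val y) == 1%N := svalP y; rewrite dy vpick0.
by case: eqP dy => // ->; rewrite dimv0.
Qed.

(** If all these minors vanished, the coordinate vectors would be proportional and span the same
    line. *)
Lemma hcoord_minor y y' : y != y' ->
  exists i j, hcoord y i * hcoord y' j - hcoord y j * hcoord y' i != 0.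
Proof.
move=> yy'; apply: contrapT => /forallNP mnr.
have [m ym] := hcoord_neq0 y; have [m' y'm'] := hcoord_neq0 y'.
have prop i : hcoord y' i = (hcoord y' m / hcoord y m) * hcoord y i.
  have /forallNP/(_ i)/negP := mnr m; rewrite negbK subr_eq0 => /eqP e.
  by apply: (mulfI ym); rewrite e mulrA mulrCA mulfV // mulr1 mulrC.
have y'E : vpick (val y') = (hcoord y' m / hcoord y m) *: vpick (val y).
  by apply/rowP => i; rewrite mxE; apply: prop.
have c0 : hcoord y' m / hcoord y m != 0.
  by apply: contraNneq y'm' => c0; rewrite prop c0 mul0r.
case/eqP: yy'; apply: val_inj; rewrite (proj_point_line y) (proj_point_line y') y'E.
apply/eqP; rewrite eqEsubv -!memvE memvZ ?memv_line // andbT.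
by rewrite -[X in X \in _](scalerK c0) memvZ ?memv_line.
Qed.

End ProjPoints.

Section Fiber.
Variables (k : fieldType) (f : 'I_4 -> {mpoly k[3]}).

Lemma fiber_ideal_minor (y : proj_point k 4) i j :
  (hcoord y i)%:MP * f j - (hcoord y j)%:MP * f i \in fiber_ideal f y.
Proof.
(* The witness is the Koszul relation [T_i f_j - T_j f_i], killed by [T_i |-> f_i t]. *)
apply/asboolP; exists ('X_i * (f j)%:MP - 'X_j * (f i)%:MP).
  apply/eqP; rewrite rmorphB !rmorphM /= !mmapC !mmapX !mmap1U; ring.
by rewrite rmorphB !rmorphM /= !mevalC !mevalXU.
Qed.
End Fiber.

(** * The Jacobian syzygy *)

(** A duplicate-free list in [P] of maximal length exhausts [P]. This turns the degree bound into
    finiteness of the set of points. *)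
Lemma bounded_fset (T : choiceType) (P : T -> Prop) (N : nat) :
  (forall r : seq T, uniq r -> (forall x, x \in r -> P x) -> (size r <= N)%N) ->
  exists Y : {fset T}, forall x, x \in Y <-> P x.
Proof.
move=> bound.
pose Q n := `[< exists r : seq T, [/\ uniq r, forall x, x \in r -> P x & size r = n] >].
have exQ : exists n, Q n by exists 0%N; apply/asboolP; exists [::].
have Q_le n : Q n -> (n <= N)%N by move=> /asboolP[r [Ur rP <-]]; apply: bound.
case: (ex_maxnP exQ Q_le) => n /asboolP[r [Ur rP <-]] max_r.
exists [fset x in r]%fset => x; rewrite inE; split=> [/rP//|Px].
apply/negPn/negP => xr; have := max_r (size r).+1; rewrite ltnn => /(_ _)/notP[] //.
apply/asboolP; exists (x :: r); split; rewrite /= ?xr //.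
by move=> z; rewrite inE => /orP[/eqP->|/rP].
Qed.

Lemma indegP (k : fieldType) n m (M : ('I_m -> {mpoly k[n]}) -> Prop) e0 :
  nonzero_in_degree M e0 ->
  exists e, [/\ indeg M = Some e, nonzero_in_degree M e & (e <= e0)%N].
Proof.
move=> M0; rewrite /indeg; case: pselect => [ex|[]]; last by exists e0; apply/asboolP.
case: ex_minnP => e /asboolP Me min; exists e; split=> //.
by apply: min; apply/asboolP.
Qed.

Section JacobianSyzygy.
Variables (k : fieldType) (f : 'I_4 -> {mpoly k[3]}).

Definition jacobian_syzygy (i : 'I_4) : {mpoly k[3]} :=
  (-1) ^+ i * \det (row' i (Jacobian f)).

Lemma jacobian_syzygyP d : (forall i, f i \is d.-homog) -> d%:R != 0 :> k ->
  Syz f jacobian_syzygy.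
Proof.
move=> fd d0; apply: (scalerI d0); rewrite scaler0 scaler_sumr.
under eq_bigr => i _ do
  rewrite scalerAr -(mpoly_Euler (fd i)) mulr_sumr.
rewrite exchange_big big1 // => j _.
transitivity ('X_j * \sum_i jacobian_syzygy i * Jacobian f i j); last first.
  by rewrite signed_minors_orthogonal mulr0.
by rewrite mulr_sumr; apply: eq_bigr => i _; rewrite mxE mulrCA.
Qed.

Lemma jacobian_syzygy_dhomog d i : (forall i, f i \is d.-homog) ->
  jacobian_syzygy i \is (3 * d.-1).-homog.
Proof.
move=> fd; rewrite /jacobian_syzygy -signr_odd rpredMsign.
by apply: dhomog_det => a b; rewrite !mxE; apply: mderiv_dhomog.
Qed.

Lemma jacobian_syzygy_neq0 u : u \in minors_ideal 3 (Jacobian f) -> u != 0 ->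
  exists i, jacobian_syzygy i != 0.
Proof.
move=> /asboolP[c uE] u0.
have [s s0] : exists s : {ffun 'I_3 -> 'I_4} * {ffun 'I_3 -> 'I_3},
    \det (mxsub s.1 s.2 (Jacobian f)) != 0.
  apply: contrapT => /forallNP s0; case/eqP: u0; rewrite uE big1 // => s _.
  by have /negP := s0 s; rewrite negbK => /eqP->; rewrite mulr0.
have [i i0] := mxsub_det_neq0 s0; exists i.
by rewrite mulf_neq0 // signr_eq0.
Qed.

(* Modulo h every f_i is a constant multiple of f_m, so modulo h the Jacobian
   matrix is a sum of two matrices of rank one. *)
Lemma divides_jacobian_syzygy (y : proj_point k 4) h :
  (forall i j, divides h ((hcoord y i)%:MP * f j - (hcoord y j)%:MP * f i)) ->
  forall i, divides h (jacobian_syzygy i).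
Proof.
move=> hf i; apply: dividesMl.
have [m ym] := hcoord_neq0 y.
(* Divide the relation for [m] and [j] by the nonzero coordinate [y_m]. *)
have /choice[g gE] j : exists g, f j = (hcoord y j / hcoord y m)%:MP * f m + g * h.
  have [g e] := hf m j; exists ((hcoord y m)^-1%:MP * g).
  have mV : (hcoord y m)^-1%:MP_[3] * (hcoord y m)%:MP_[3] = 1.
    by rewrite -mpolyCM mulVf.
  by rewrite -mulrA -e mulrBr mulrA mV mpolyCM; ring.
pose u j := (f m)^`M(j); pose v j := h^`M(j).
rewrite -[X in divides h X]subr0.
rewrite -(det3_rank2 (fun a => (hcoord y (lift i a) / hcoord y m)%:MP) (fun a => g (lift i a)) u v).
(* By the product rule, the entries differ only by [h] times a derivative of [g]. *)
apply: divides_detB => a b; rewrite !mxE [in (f _)^`M(b)]gE mderivD mderiv_mulC mderivM.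
by exists ((g (lift i a))^`M(b)); rewrite /u /v; ring.
Qed.

End JacobianSyzygy.

(** * Common factors of the generators *)

Section CommonFactor.
Variables (k : fieldType) (f : 'I_4 -> {mpoly k[3]}).

Lemma common_divisor (y y' : proj_point k 4) q : y != y' ->
  (forall i j, divides q ((hcoord y i)%:MP * f j - (hcoord y j)%:MP * f i)) ->
  (forall i j, divides q ((hcoord y' i)%:MP * f j - (hcoord y' j)%:MP * f i)) ->
  forall i, divides q (f i).
Proof.
move=> yy' qy qy'.
have divC (c : k) u : c != 0 -> divides q (c%:MP * u) -> divides q u.
  by move=> c0 [w e]; exists (c^-1%:MP * w); rewrite -mulrA -e mulrA -mpolyCM mulVf // mul1r.
(* Eliminating [f j] from the relations at [y] and [y'] leaves the 2x2 minor times [f i]. *)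
have key i j : hcoord y i * hcoord y' j - hcoord y j * hcoord y' i != 0 ->
    divides q (f i).
  move=> /divC; apply.
  rewrite (_ : _ * _ = (hcoord y i)%:MP * ((hcoord y' j)%:MP * f i - (hcoord y' i)%:MP * f j)
     - (hcoord y' i)%:MP * ((hcoord y j)%:MP * f i - (hcoord y i)%:MP * f j)).
    by apply: dividesB; apply: dividesMl.
  by rewrite mpolyCB !mpolyCM; ring.
have [i [j dij]] := hcoord_minor yy'.
have qi := key i j dij => l.
(* The nonzero minor makes [y_i] or [y'_i] nonzero, and the corresponding relation passes
   divisibility from [f i] to every [f l]. *)
have [yi|yi] := eqVneq (hcoord y i) 0; last first.
  apply: (divC _ _ yi); rewrite -[_ * _](subrK ((hcoord y l)%:MP * f i)).
  by apply: dividesD; [|apply: dividesMl].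
have y'i : hcoord y' i != 0.
  by apply: contraNneq dij => y'i; rewrite yi y'i mul0r mulr0 subr0.
apply: (divC _ _ y'i); rewrite -[_ * _](subrK ((hcoord y' l)%:MP * f i)).
by apply: dividesD; [|apply: dividesMl].
Qed.

(** Otherwise [(q)] would be a prime containing all the [f i], hence of height at least 2, which a
    principal prime cannot have. *)
Lemma codim2_no_common_prime q : has_codim (gen_ideal xpredT f) 2 ->
  prime_elt q -> ~ forall i, divides q (f i).
Proof.
move=> [_ ht] qP qf; apply: (principal_height qP).
apply: ht; first exact: prime_principal_ideal.
move=> u /asboolP[c ->]; apply/principal_idealP; apply: divides_sum => i _.
exact: dividesMl.
Qed.

End CommonFactor.

Lemma has_characteristic_natr (k : fieldType) p d :
  has_characteristic k p -> ~~ (p %| d)%N -> d%:R != 0 :> k.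
Proof.
rewrite /has_characteristic; case: eqP => [->|_] hp; last by rewrite (dvdn_pcharf hp).
by rewrite dvd0n; move/pcharf0P: hp => ->.
Qed.

Lemma dhomog0_const (k : fieldType) n (p : {mpoly k[n]}) :
  p \is 0.-homog -> p = (p@_0%MM)%:MP.
Proof.
move=> p0; apply/mpolyP => m; rewrite mcoeffC eq_sym.
have [->|m0] := eqVneq m 0%MM; first by rewrite mulr1.
by rewrite mulr0 (dhomog_nemf_coeff p0) // mdeg_eq0.
Qed.

Lemma minimal_generators_syz0 (k : fieldType) (f : 'I_4 -> {mpoly k[3]}) :
  minimal_generators f -> ~ nonzero_in_degree (Syz f) 0.
Proof.
move=> fmin [b [bS b0 [i bi]]]; apply/negP: (fmin i); rewrite negbK.
pose c := (b i)@_0%MM; have biE : b i = c%:MP by apply: dhomog0_const.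
have c0 : c != 0 by apply: contraNneq bi => c0; rewrite biE c0.
(* The entry [b i] is the nonzero constant [c], so the relation can be solved for [f i]. *)
apply/asboolP; exists (fun j => - c^-1%:MP * b j).
under eq_bigr => j _ do rewrite -mulrA.
rewrite -mulr_sumr -[f i]mul1r -(mpolyC1 3) -(mulVf c0) mpolyCM -mulrA mulNr -mulrN.
congr (_ * _); rewrite -biE; apply/eqP; rewrite -addr_eq0.
by have /eqP := bS; rewrite (bigD1 i).
Qed.

Lemma dhomog_prod_seq (k : fieldType) n (I : eqType) (r : seq I) (F : I -> {mpoly k[n]})
    (e : I -> nat) :
  (forall i, i \in r -> F i \is (e i).-homog) ->
  \prod_(i <- r) F i \is (\sum_(i <- r) e i)%N.-homog.
Proof.
elim: r => [|i r IH] Fe; first by rewrite !big_nil dhomog1.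
rewrite !big_cons dhomogM ?Fe ?mem_head // IH // => j jr.
by rewrite Fe // inE jr orbT.
Qed.

(** * Curves in the fibers and the degree bound *)

Section FiberCurves.
Variables (k : fieldType) (d : nat) (f : 'I_4 -> {mpoly k[3]}).
Variable h : proj_point k 4 -> {mpoly k[3]}.
Hypothesis f_homog : forall i, f i \is d.-homog.
Hypothesis f_codim : has_codim (gen_ideal xpredT f) 2.
Hypothesis f_jac : exists2 u, u \in minors_ideal 3 (Jacobian f) & u != 0.
Hypothesis d_neq0 : d%:R != 0 :> k.
Hypothesis h_fiber : forall y, one_dim_fiber f y ->
  defines_unmixed_part (fiber_ideal f y) 1 (h y).

Lemma divides_fiber_minor y i j : one_dim_fiber f y ->
  divides (h y) ((hcoord y i)%:MP * f j - (hcoord y j)%:MP * f i).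
Proof. by move=> /h_fiber hy; apply: unmixed_part_mem hy (fiber_ideal_minor _ _ _ _). Qed.

(** [h y] is nonzero because it divides a nonzero entry of the Jacobian syzygy, and a nonunit
    because the fiber has dimension 1. *)
Lemma fiber_curve_msize y : one_dim_fiber f y -> (1 < msize (h y))%N.
Proof.
move=> y1; apply: mpoly_nonunit_msize (unmixed_part_nonunit (h_fiber y1) y1).
have [u uJ /(jacobian_syzygy_neq0 uJ)[i]] := f_jac; apply: contraNneq => h0.
have [c ->] := divides_jacobian_syzygy (fun i j => divides_fiber_minor i j y1) i.
by rewrite h0 mulr0.
Qed.

(** Stated for arbitrary finite lists of points, it serves both for finiteness and for the final
    bound; [(msize (h y)).-1] is the degree of [h y]. *)
Lemma fiber_curves_syzygy (r : seq (proj_point k 4)) :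
  uniq r -> (forall y, y \in r -> one_dim_fiber f y) ->
  let D := (\sum_(y <- r) (msize (h y)).-1)%N in
  (D <= 3 * d.-1)%N /\ nonzero_in_degree (Syz f) (3 * d.-1 - D).
Proof.
move=> Ur r1 D; pose H := \prod_(y <- r) h y.
have HD : H \is D.-homog.
  apply: dhomog_prod_seq => y /r1/h_fiber[hy _].
  by rewrite -homog_msize.
have H0 : H != 0.
  rewrite prodf_seq_neq0; apply/allP => y /r1/fiber_curve_msize hy /=.
  by rewrite -msize_poly_eq0 -lt0n (ltnW hy).
have /choice[b bE] i : divides H (jacobian_syzygy f i).
  apply: divides_coprime_prod => // [y /r1/fiber_curve_msize hy|y /r1 y1|].
  - by apply: factorial_mpoly; rewrite -msize_poly_eq0 -lt0n (ltnW hy).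
  - by apply: divides_jacobian_syzygy => a c; apply: divides_fiber_minor.
  - move=> y y' q /r1 y1 /r1 y'1 yy' qP qh qh'.
    apply: (codim2_no_common_prime f_codim qP); apply: (common_divisor yy') => a c.
      exact: divides_trans qh (divides_fiber_minor _ _ _).
    exact: divides_trans qh' (divides_fiber_minor _ _ _).
(* Degrees are read off from nonzero quotients; a zero entry is homogeneous of every degree. *)
have cof i : b i != 0 -> (D <= 3 * d.-1)%N /\ b i \is (3 * d.-1 - D).-homog.
  move=> bi; apply: (dhomog_cofactor HD); rewrite mulrC -bE.
    exact: jacobian_syzygy_dhomog.
  by rewrite bE mulf_neq0.
have [u uJ /(jacobian_syzygy_neq0 uJ)[i]] := f_jac.
rewrite bE mulf_eq0 => /norP[bi _]; split; first by case: (cof i bi).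
exists b; split; last by exists i.
- apply: (mulIf H0); rewrite mul0r mulr_suml -[RHS](jacobian_syzygyP f_homog d_neq0).
  by apply: eq_bigr => j _; rewrite bE mulrAC.
- by move=> j; have [->|/cof[]] := eqVneq (b j) 0; first exact: dhomog0.
Qed.

Lemma finite_one_dim_fibers :
  exists Y : {fset proj_point k 4}, forall y, y \in Y <-> one_dim_fiber f y.
Proof.
apply: (bounded_fset (N := 3 * d.-1)) => r Ur r1.
have [le _] := fiber_curves_syzygy Ur r1; apply: leq_trans le.
(* Each curve adds at least 1 to the degree sum, which thus bounds the number of points. *)
rewrite -sum1_size big_seq [X in (_ <= X)%N]big_seq; apply: leq_sum => y /r1/fiber_curve_msize.
by case: (msize _) => [|[]].
Qed.

End FiberCurves.

Theorem corollary4p4 (k : closedFieldType) (p : nat)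
  (hp : has_characteristic k p)
  (d : nat) (f : 'I_4 -> {mpoly k[3]})
  (f_homog : forall i, f i \is d.-homog)
  (f_min : minimal_generators f)
  (I_codim : has_codim (gen_ideal xpredT f) 2)
  (f_genfin : generically_finite f)
  (f_jac : exists2 u, u \in minors_ideal 3 (Jacobian f) & u != 0)
  (p_ndvd_d : ~~ (p %| d)%N)
  (h : proj_point k 4 -> {mpoly k[3]})
  (hh : forall y, one_dim_fiber f y ->
        defines_unmixed_part (fiber_ideal f y) 1 (h y)) :
  exists Y : {fset proj_point k 4},
    (forall y, y \in Y <-> one_dim_fiber f y) /\
    exists e : nat, indeg (Syz f) = Some e /\
      (((\sum_(y <- Y) (msize (h y)).-1)%N)%:Z <= 3 * (d%:Z - 1) - e%:Z /\
       3 * (d%:Z - 1) - e%:Z < 3 * (d%:Z - 1) :> int).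
Proof.
have d_neq0 := has_characteristic_natr hp p_ndvd_d.
(* Positivity of [d] identifies the truncated [3 * d.-1] with the integer [3 * (d - 1)]. *)
have d_gt0 : (0 < d)%N by rewrite lt0n; apply: contraNneq d_neq0 => ->.
have [Y YE] := finite_one_dim_fibers f_homog I_codim f_jac d_neq0 hh.
exists Y; split=> //.
have [le] := fiber_curves_syzygy f_homog I_codim f_jac d_neq0 hh
  (fset_uniq Y) (fun y => (YE y).1).
move=> /indegP[e [eE e_nz e_le]]; exists e; split=> //.
(* This gives the strict inequality. *)
have e_gt0 : (0 < e)%N.
  by rewrite lt0n; apply/eqP => e0; rewrite e0 in e_nz; case: (minimal_generators_syz0 f_min).
(* As [D <= 3 * d.-1], the truncated difference bounding [e] is the true one. *)
move: le e_le; move: (\sum_(y <- Y) _)%N => D le e_le.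
split; lia.
Qed.
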